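(* Let $d>2$ and let $u$ be an infinite word over the alphabet $\{0,1,\dots,d-1\}$ having the WELLDOC property. Let $\varphi$ be the morphism defined by $\varphi(d-1)=0$ and $\varphi(i)=i$ for $i=0,\dots,d-2$. Then $\varphi(u)$, an infinite word over the alphabet $\{0,1,\dots,d-2\}$, has the WELLDOC property.
   Context: For an infinite word $u=u_0u_1\cdots$ and a morphism $\varphi$ of words, $\varphi(u)=\varphi(u_0)\varphi(u_1)\cdots$. An infinite word is aperiodic if it is not of the form $vw^\omega$ with $v,w$ finite words ($w$ nonempty; $w^\omega$ is the infinite repetition of $w$). A finite word $w$ is a factor of $u$ if $w=u_i\cdots u_{i+|w|-1}$ for some $i$; each such $i$ is an occurrence of $w$ in $u$. $\mathrm{Pref}_n u=u_0\cdots u_{n-1}$, and $|v|_a$ is the number of occurrences of the letter $a$ in the finite word $v$. WELLDOC property: an aperiodic infinite word $u$ over an alphabet $\{0,1,\dots,k-1\}$ has the WELLDOC property if for every positive integer $m$ and every factor $w$ of $u$, denoting by $i_0,i_1,\dots$ the occurrences of $w$ in $u$, one has $$\{(|\mathrm{Pref}_{i_j}u|_0,\dots,|\mathrm{Pref}_{i_j}u|_{k-1})\bmod m : j\in\mathbb N\}=\mathbb Z_m^k.$$ *)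

(* Defs.v *)
From mathcomp Require Import all_boot.

Set Implicit Arguments.
Unset Strict Implicit.
Unset Printing Implicit Defensive.

Definition infword (A : Type) := nat -> A.

Section Words.
Variable A : eqType.
Implicit Types (u : infword A) (v w : seq A) (a : A).

Definition Pref (n : nat) u : seq A := mkseq u n.

(* The infinite repetition of the nonempty word a :: w; since the index is
   reduced modulo its length, the default argument of nth is never returned. *)
Definition omega_power a w : infword A :=
  fun n => nth a (a :: w) (n %% size (a :: w)).

Definition prepend v u : infword A :=
  fun n => if n < size v then nth (u 0) v n else u (n - size v).

Definition aperiodic u : Prop :=
  ~ exists v a w, u =1 prepend v (omega_power a w).

Definition occurrence u w (i : nat) : Prop := map u (iota i (size w)) = w.

Definition factor u w : Prop := exists i, occurrence u w i.

End Words.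

(* Z_m is represented by the residues 'I_m, which is correct for every m > 0
   including m = 1 (unlike 'Z_m). Vectors of residues always belong to Z_m^k,
   so equality with Z_m^k amounts to every vector x being reached. *)
Definition WELLDOC (k : nat) (u : infword 'I_k) : Prop :=
  aperiodic u /\
  forall (m : nat) (w : seq 'I_k), 0 < m -> factor u w ->
  forall x : {ffun 'I_k -> 'I_m},
  exists i, occurrence u w i /\
            forall a : 'I_k, count_mem a (Pref i u) %% m = x a.

(* A morphism sending letters to letters acts on infinite words letterwise. *)
Definition apply_coding (A B : Type) (phi : A -> B) (u : infword A) :
  infword B := fun n => phi (u n).

Lemma predn_gt0_of_gt2 d : 2 < d -> 0 < d.-1.
Proof. by case: d => [|[|d]]. Qed.

(* insubd keeps the letters below d.-1 and sends the remaining one, d.-1,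
   to its default value 0. *)
Definition merge_last (d : nat) (d_gt2 : 2 < d) (i : 'I_d) : 'I_(d.-1) :=
  insubd (Ordinal (predn_gt0_of_gt2 d_gt2)) (val i).

Lemma merge_last_max d (d_gt2 : 2 < d) (i : 'I_d) :
  i = d.-1 :> nat -> merge_last d_gt2 i = 0 :> nat.
Proof. by move=> di; rewrite /merge_last val_insubd /= di ltnn. Qed.

Lemma merge_last_id d (d_gt2 : 2 < d) (i : 'I_d) :
  i < d.-1 -> merge_last d_gt2 i = i :> nat.
Proof. by move=> di; rewrite /merge_last val_insubd /= di. Qed.

(* Main.v *)
Require Import Defs.
From mathcomp Require Import all_boot.

Set Implicit Arguments.
Unset Strict Implicit.
Unset Printing Implicit Defensive.

(** An occurrence of [w] in [u] is also an occurrence of the image of [w] in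
    the image of [u], and merging the last letter into [0] adds the number of
    its occurrences in the prefix to that of [0] ([count_mem_merge_last]).  To
    reach a residue vector [x] at an occurrence of a factor of the image, take
    a factor of [u] lying above it and ask, in [u], for the vector that extends
    [x] by the value [0] at the last letter ([merge_last_WELLDOC_reaches]).

    Aperiodicity of the image follows from this surjectivity alone, since the
    image alphabet still has at least two letters.  If a word has period [p]
    from position [N] on, the letter counts of its prefixes modulo [m] have
    period [p * m] from [N] on, so the vector of counts takes at most
    [N + p * m] values; this is less than [m ^ 2] when [m = N + p + 1]
    ([aperiodic_of_Pref_surjective]). *)

Section EventuallyPeriodic.
Variables (A : eqType) (u : infword A) (N p : nat).
Hypothesis u_per : forall i, N <= i -> u (i + p) = u i.

Lemma count_mem_periods a i n : N <= i ->
  count_mem a (map u (iota i (p * n))) = n * count_mem a (map u (iota i p)).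
Proof.
move=> Ni; elim: n => [|n IHn]; first by rewrite muln0.
rewrite mulnS iotaD map_cat count_cat mulSn -IHn; congr (_ + count_mem a _).
rewrite [i + p]addnC iotaDl -map_comp; apply/eq_in_map => j.
by rewrite mem_iota => /andP[ij _] /=; rewrite addnC u_per // (leq_trans Ni).
Qed.

Lemma count_mem_Pref_periodic_mod a m i q : N <= i ->
  count_mem a (Pref (i + p * m * q) u) = count_mem a (Pref i u) %[mod m].
Proof.
move=> Ni; rewrite /Pref /mkseq iotaD map_cat count_cat add0n -mulnA.
by rewrite count_mem_periods // -mulnA mulnC addnC modnMDl.
Qed.

End EventuallyPeriodic.

Lemma eventually_periodic_of_omega_power (A : eqType) (u : infword A) v a w :
  u =1 prepend v (omega_power a w) ->
  forall i, size v <= i -> u (i + size (a :: w)) = u i.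
Proof.
move=> u_eq i vi; rewrite !u_eq /prepend !ltnNge vi (leq_trans vi) ?leq_addr //=.
by rewrite -addnBAC // /omega_power /= modnDr.
Qed.

Lemma aperiodic_of_Pref_surjective k (u : infword 'I_k) : 1 < k ->
  (forall m, 0 < m -> forall x : {ffun 'I_k -> 'I_m},
     exists i, forall a, count_mem a (Pref i u) %% m = x a) ->
  aperiodic u.
Proof.
move=> k_gt1 u_surj [v [a [w /eventually_periodic_of_omega_power]]].
move: (size v) (size _) (isT : 0 < size (a :: w)) => N p p_gt0 u_per.
pose m := (N + p).+1; have pm_gt0 : 0 < p * m by rewrite muln_gt0 p_gt0.
pose g (j : 'I_(N + p * m)) : {ffun 'I_k -> 'I_m} :=
  [ffun b => inord (count_mem b (Pref j u) %% m)].
have g_onto x : x \in codom g.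
  have [i ix] := u_surj m isT x.
  (* Replace i by a position below N + p * m with the same counts modulo m. *)
  have [j jx] : exists j : 'I_(N + p * m),
      forall b, count_mem b (Pref j u) %% m = x b.
    have [iN|Ni] := ltnP i N.
      by exists (Ordinal (leq_trans iN (leq_addr (p * m) N))).
    have lt_j : N + (i - N) %% (p * m) < N + p * m by rewrite ltn_add2l ltn_pmod.
    exists (Ordinal lt_j) => b; rewrite -ix -[in RHS](subnKC Ni).
    rewrite [in RHS](divn_eq (i - N) (p * m)) /= [_ %/ _ * _ + _]addnC addnA.
    by rewrite [_ %/ _ * _]mulnC (count_mem_Pref_periodic_mod u_per) ?leq_addr.
  apply/codomP; exists j; apply/ffunP => b; apply: val_inj.
  by rewrite ffunE jx inord_val.
have: m ^ k <= N + p * m.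
  rewrite -[m in m ^ k]card_ord -[k in _ ^ k]card_ord -card_ffun.
  rewrite -[N + _]card_ord -(eq_card g_onto).
  exact: leq_image_card.
apply/negP; rewrite -ltnNge (leq_trans _ (leq_pexp2l (isT : 0 < m) k_gt1)) //.
apply: (@leq_trans (p.+1 * m)); first by rewrite mulSn ltn_add2r ltnS leq_addr.
by rewrite expnS expn1 leq_mul2r ltnS leq_addl orbT.
Qed.

Section MergeLast.
Variables (d : nat) (d_gt2 : 2 < d).
Local Notation phi := (merge_last d_gt2).

Lemma merge_last_widen (a : 'I_d.-1) : phi (widen_ord (leq_pred d) a) = a.
Proof. by apply: val_inj; rewrite /= merge_last_id /=. Qed.

Lemma count_mem_merge_last (l : 'I_d) (a : 'I_d.-1) s : l = d.-1 :> nat ->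
  count_mem a (map phi s) =
  count_mem (widen_ord (leq_pred d) a) s + (a == 0 :> nat) * count_mem l s.
Proof.
move=> l_last; elim: s => [|b s IHs] /=; first by rewrite muln0.
rewrite IHs mulnDr addnACA; congr (_ + _).
rewrite -!val_eqE /= l_last; have := ltn_ord a.
case: (ltnP b d.-1) => bd ad.
  by rewrite merge_last_id // (ltn_eqF bd) muln0 addn0.
have b_last : b = d.-1 :> nat.
  by apply/eqP; rewrite eqn_leq bd -ltnS prednK ?ltn_ord // (ltn_trans _ d_gt2).
by rewrite merge_last_max // b_last eqxx (gtn_eqF ad) muln1 eq_sym.
Qed.

Lemma merge_last_WELLDOC_reaches (u : infword 'I_d) : WELLDOC u ->
  forall m (w : seq 'I_d.-1), 0 < m -> factor (apply_coding phi u) w ->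
  forall x : {ffun 'I_d.-1 -> 'I_m},
  exists i, occurrence (apply_coding phi u) w i /\
    forall a, count_mem a (Pref i (apply_coding phi u)) %% m = x a.
Proof.
move=> [_ u_surj] m w m_gt0 [i0 w_i0] x.
have lt_l : d.-1 < d by rewrite ltn_predL (ltn_trans _ d_gt2).
pose l := Ordinal lt_l.
pose w' := map u (iota i0 (size w)).
have size_w' : size w' = size w by rewrite size_map size_iota.
have w'_factor : factor u w' by exists i0; rewrite /occurrence size_w'.
pose y : {ffun 'I_d -> 'I_m} :=
  [ffun b => if b == l then Ordinal m_gt0 else x (phi b)].
have [i [w'_i iy]] := u_surj m w' m_gt0 w'_factor y.
exists i; split=> [|a].
  by rewrite /occurrence -size_w' [LHS](map_comp phi) w'_i -map_comp.
rewrite /Pref /mkseq (map_comp phi u) (@count_mem_merge_last l) //.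
have l_mod : count_mem l (Pref i u) = 0 %[mod m].
  by rewrite iy ffunE eqxx mod0n.
rewrite -modnDmr -modnMmr l_mod mod0n muln0 mod0n addn0 iy ffunE.
by rewrite -val_eqE /= (ltn_eqF (ltn_ord a)) merge_last_widen.
Qed.

End MergeLast.

Theorem mainTheorem5 (d : nat) (d_gt2 : 2 < d) (u : infword 'I_d)
    (u_welldoc : WELLDOC u) :
  WELLDOC (apply_coding (merge_last d_gt2) u).
Proof.
have reaches := merge_last_WELLDOC_reaches (d_gt2 := d_gt2) u_welldoc.
split; last exact: reaches.
apply: aperiodic_of_Pref_surjective => [|m m_gt0 x].
  by rewrite ltn_predRL.
(* The empty word occurs everywhere. *)
have nil_factor : factor (apply_coding (merge_last d_gt2) u) [::] by exists 0.
by have [i [_ ix]] := reaches m [::] m_gt0 nil_factor x; exists i.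
Qed.
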